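(* In the $n$-node line network described in the context, with rates $\mu_0,\ldots,\mu_{n-1}>0$, there exists $s_0>0$ such that for all $s<s_0$ and each $k\in\{1,\ldots,n\}$, $$\lim_{t\to\infty}\mathbb{E}\left[e^{sx_k(t)}\right]=\prod_{i=0}^{k-1}\frac{\mu_i}{\mu_i-s}.$$
   Context: The line network is the following age process. There are monitors at nodes $1,\ldots,n$ with ages $\mathbf{x}(t)=[x_1(t)\ \cdots\ x_n(t)]$; each age grows at unit rate between events. There are $n$ independent Poisson event processes with rates $\mu_0,\ldots,\mu_{n-1}$. At an event of process $0$, $x_1$ is reset to $0$ and all other ages are unchanged. At an event of process $l\in\{1,\ldots,n-1\}$, $x_{l+1}$ is reset to $x_l$ and all other ages are unchanged. (Equivalently, this is the age process of a line of preemptive memoryless $\cdot$/M/1/1 servers with service rates $\mu_1,\ldots,\mu_{n-1}$ fed by a rate-$\mu_0$ Poisson source of fresh updates.) *)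

(* Defs.v *)
From HB Require Import structures.
From mathcomp Require Import all_boot all_order all_algebra.
From mathcomp Require Import all_classical all_reals all_analysis.
Set Implicit Arguments. Unset Strict Implicit. Unset Printing Implicit Defensive.
Import Order.TTheory GRing.Theory Num.Theory.
Import numFieldNormedType.Exports.
Local Open Scope classical_set_scope.
Local Open Scope ring_scope.

(* Conventions: processes are indexed l = 0..n-1 as in the paper; nodes are
   indexed 0-based, node k (0 <= k < n) being the paper's node k+1.
   Process l (l >= 1) resets node l (paper node l+1) to the age of node l-1
   (paper node l); process 0 resets node 0 (paper node 1) to 0. *)

Definition evtime {R : realType} (S : nat -> R) (j : nat) : R :=
  \sum_(i < j.+1) S i.

Definition lastev {R : realType} (T : nat -> R) (t : R) : option R :=
  if `[< exists j, T j <= t >] then Some (sup [set T j | j in [set j | T j <= t]])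
  else None.

(* Pathwise age process.  x0 = initial ages at time 0; T l = event times of
   process l.  Between events each age grows at unit rate; at the last event
   tau <= t of the process resetting node k, node k received the age of the
   upstream node (0 for node 0). *)
Fixpoint age {R : realType} (x0 : nat -> R) (T : nat -> nat -> R) (k : nat)
    (t : R) : R :=
  match k with
  | 0 => match lastev (T 0%N) t with Some tau => t - tau | None => x0 0%N + t end
  | k'.+1 => match lastev (T k) t with
             | Some tau => age x0 T k' tau + (t - tau)
             | None => x0 k + t end
  end.

Definition mutually_independent {d} {Omega : measurableType d} {R : realType}
    (P : probability Omega R) {I : eqType} (D : set I) (X : I -> Omega -> R) : Prop :=
  forall (F : seq I) (B : I -> set R),
    uniq F -> (forall i, i \in F -> D i /\ measurable (B i)) ->
    fine (P (\bigcap_(i in [set i | i \in F]) (X i @^-1` B i))) =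
    \prod_(i <- F) fine (P (X i @^-1` B i)).

(* Main.v *)
Require Import Defs.
From HB Require Import structures.
From mathcomp Require Import all_boot all_order all_algebra.
From mathcomp Require Import all_classical all_reals all_analysis.
From mathcomp Require Import measurable_realfun ring lra.
Import Order.TTheory GRing.Theory Num.Theory.
Import numFieldNormedType.Exports.
Local Open Scope classical_set_scope.
Local Open Scope ring_scope.

(* At time t, look back to the last event of process k. By the memoryless
   property the time elapsed since then is distributed as min(Y, t), where Y is
   exponential with rate mu_k, and it is independent of the processes with a
   smaller index. Hence f_k(t) = E[exp(s x_k(t))] satisfies the renewal equation
     f_k(t) = E[1_{Y < t} exp(s Y) f_{k-1}(t - Y)] + P(Y >= t) exp(s (x0_k + t)),
   with f_{-1} = 1. For s < mu_k, dominated convergence gives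
   lim f_k = E[exp(s Y)] * lim f_{k-1} = mu_k / (mu_k - s) * lim f_{k-1}, and
   s0 can be taken as the smallest rate. *)

(** * Independence of disjoint blocks *)

(** Two points shape the development. The independence hypothesis speaks of finite families of
    single interarrival times, whereas an age depends on infinitely many of them; it has to be
    raised to the sigma-algebras generated by disjoint blocks before an expectation can be factored.
    And the memoryless property is obtained with neither Poisson counts nor Gamma densities: almost
    surely the partial sums of interarrival times straddle a given instant exactly once, and
    conditioning on the left end of the straddling interval yields the factor exp(- mu (v - u)) for
    each index, hence for the sum over all indices. Finally, dominated convergence asks for a bound
    on f_(k-1) uniform over nonnegative times, so the induction on the node carries such a bound
    together with the limit. *)

Section independence.
Context {d} {T : measurableType d} {R : realType} (P : probability T R).

(** For fixed [B], the measurable sets satisfying the product formula form a Dynkin system; it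
    contains the pi-system [G], hence also the sigma-algebra that [G] generates. *)
Lemma indep_sigma_l (G : set (set T)) (B : set T) :
  setI_closed G -> G `<=` measurable -> measurable B ->
  (forall A, G A -> P (A `&` B) = (P A * P B)%E) ->
  forall A, <<s G >> A -> P (A `&` B) = (P A * P B)%E.
Proof.
move=> GI Gm mB GB A sA.
suff : <<s G >> `<=` [set C | measurable C /\ P (C `&` B) = (P C * P B)%E].
  by move=> /(_ _ sA)[].
rewrite -(setI_closed_g_dynkin_g_sigma_algebra GI); apply: smallest_sub; last first.
  by move=> C GC; split; [exact: Gm|exact: GB].
split => /=.
- by split => //; rewrite setTI probability_setT mul1e.
- move=> C [mC PC]; split; first exact: measurableC.
  rewrite setIC -setDE measureD//; last by rewrite (le_lt_trans (probability_le1 _ _)) ?ltry.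
  rewrite (setIC B C) [X in (_ - X)%E]PC (probability_setC P mC) muleBl//.
  + by rewrite mul1e.
  + exact: fin_num_measure.
- move=> F tF HF; have mF n : measurable (F n) by have [] := HF n.
  split; first exact: bigcup_measurable.
  rewrite setI_bigcupl.
  rewrite measure_bigcup//; last 2 first.
  + by move=> i _; exact: measurableI.
  + exact: trivIset_setIr.
  rewrite measure_bigcup//.
  rewrite muleC -[X in (X * _)%E](fineK (fin_num_measure P _ mB)).
  rewrite -nneseriesZl//; apply: eq_eseriesr => i _.
  by rewrite fineK ?fin_num_measure// muleC; have [] := HF i.
Qed.

Lemma indep_sigma (G H : set (set T)) :
  setI_closed G -> G `<=` measurable -> setI_closed H -> H `<=` measurable ->
  (forall A B, G A -> H B -> P (A `&` B) = (P A * P B)%E) ->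
  forall A B, <<s G >> A -> <<s H >> B -> P (A `&` B) = (P A * P B)%E.
Proof.
move=> GI Gm HI Hm GH A B sA sB.
have mH : <<s H >> `<=` measurable.
  by apply: smallest_sub => //; exact: sigma_algebra_measurable.
apply: (indep_sigma_l G) => //; first exact: mH.
move=> {sA}A GA.
rewrite setIC muleC; apply: (indep_sigma_l H) => //; first exact: Gm.
by move=> C HC; rewrite setIC muleC; exact: GH.
Qed.

Context {I : choiceType} (X : I -> T -> R).

(* A pi-system generating the sigma-algebra of the X i with i in D. *)
Definition cylinders (D : set I) : set (set T) :=
  [set A | exists (F : seq I) (B : I -> set R),
     [/\ uniq F, forall i, i \in F -> D i /\ measurable (B i) &
         A = \bigcap_(i in [set i | i \in F]) (X i @^-1` B i)]].

Lemma cylinders_setI_closed (D : set I) : setI_closed (cylinders D).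
Proof.
move=> _ _ [F [B [_ HB ->]]] [F' [B' [_ HB' ->]]].
(* An index listed on one side only is constrained by [setT] on the other, and [undup] restores the
   uniqueness asked of a cylinder. *)
exists (undup (F ++ F')), (fun i => (if i \in F then B i else setT) `&`
   (if i \in F' then B' i else setT)); split.
- exact: undup_uniq.
- move=> i; rewrite mem_undup mem_cat => iFF; split.
    by case/orP: iFF => [/HB[]|/HB'[]].
  by apply: measurableI; [case: ifPn => // /HB[]|case: ifPn => // /HB'[]].
- apply/seteqP; split => w /=.
    move=> [h h'] i /=; rewrite mem_undup mem_cat => _; split.
      by case: ifPn => // ?; exact: h.
    by case: ifPn => // ?; exact: h'.
  by move=> h; split => i /= iF; have /= := h i;
    rewrite mem_undup mem_cat iF ?orbT => /(_ isT) [].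
Qed.

Lemma cylinders_measurable (D : set I) :
  (forall i, D i -> measurable_fun setT (X i)) ->
  cylinders D `<=` measurable.
Proof.
move=> mX _ [F [B [_ HB ->]]].
apply: fin_bigcap_measurable => [|i iF]; first exact: finite_seq.
by have [Di mB] := HB _ iF; rewrite -[X in measurable X]setTI; exact: mX.
Qed.

(** Cylinders over disjoint index sets have lists that concatenate without repetition, so mutual
    independence of the joint list splits into the two products; [indep_sigma] then passes to the
    sigma-algebras. *)
Lemma cylinders_indep (D D1 D2 : set I) :
  mutually_independent P D X -> D1 `<=` D -> D2 `<=` D ->
  (forall i, D i -> measurable_fun setT (X i)) -> [disjoint D1 & D2] ->
  forall A B, <<s cylinders D1 >> A -> <<s cylinders D2 >> B ->
  P (A `&` B) = (P A * P B)%E.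
Proof.
move=> indX D1D D2D mX /disj_set2P D12.
have mX1 i : D1 i -> measurable_fun setT (X i) by move/D1D; exact: mX.
have mX2 i : D2 i -> measurable_fun setT (X i) by move/D2D; exact: mX.
apply: indep_sigma; [exact: cylinders_setI_closed|exact: cylinders_measurable|
  exact: cylinders_setI_closed|exact: cylinders_measurable|].
move=> A B cA cB.
have mA := cylinders_measurable _ mX1 _ cA.
have mB := cylinders_measurable _ mX2 _ cB.
apply/eqP; rewrite -(fineK (fin_num_measure P _ mA)).
rewrite -(fineK (fin_num_measure P _ mB)).
rewrite -(fineK (fin_num_measure P _ (measurableI _ _ mA mB))) -EFinM; apply/eqP.
congr (_%:E).
case: cA => F [C [uF HC ->]]; case: cB => F' [C' [uF' HC' ->]].
have disj i : i \in F -> i \in F' -> False.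
  move=> /HC[D1i _] /HC'[D2i _]; have : (D1 `&` D2) i by [].
  by rewrite D12.
pose C2 i := if i \in F then C i else C' i.
have EF i : i \in F -> C2 i = C i by rewrite /C2 => ->.
have EF' i : i \in F' -> C2 i = C' i.
  by move=> iF'; rewrite /C2; case: ifPn => // /disj /(_ iF').
have -> : (\bigcap_(i in [set i | i \in F]) X i @^-1` C i) `&`
   (\bigcap_(i in [set i | i \in F']) X i @^-1` C' i) =
   \bigcap_(i in [set i | i \in F ++ F']) X i @^-1` C2 i.
  apply/seteqP; split => w /=.
    move=> [h h'] i /=; rewrite mem_cat => /orP[] iF.
      by rewrite EF//; exact: h.
    by rewrite EF'//; exact: h'.
  move=> h; split => i /= iF.
    by rewrite -EF//; apply: h; rewrite /= mem_cat iF.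
  by rewrite -EF'//; apply: h; rewrite /= mem_cat iF orbT.
rewrite indX; last 2 first.
- rewrite cat_uniq uF uF' andbT /=; apply/hasPn => i iF' /=.
  by apply/negP => /disj /(_ iF').
- move=> i; rewrite mem_cat => /orP[] iF.
    by rewrite EF//; have [/D1D] := HC _ iF.
  by rewrite EF'//; have [/D2D] := HC' _ iF.
rewrite big_cat/= indX//; last by move=> i /HC[/D1D].
rewrite indX//; last by move=> i /HC'[/D2D].
congr (_ * _); apply: eq_big_seq => i iF; first by rewrite -(EF _ iF).
by rewrite -(EF' _ iF).
Qed.

End independence.

Lemma measurable_lt_set {d} {T : measurableType d} {R : realType} (f g : T -> R) :
  measurable_fun setT f -> measurable_fun setT g ->
  measurable [set x | f x < g x].
Proof.
move=> mf mg; have := measurable_fun_ltr mf mg.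
by move=> /(_ measurableT [set true] Logic.I); rewrite setTI.
Qed.

Lemma measurable_le_set {d} {T : measurableType d} {R : realType} (f g : T -> R) :
  measurable_fun setT f -> measurable_fun setT g ->
  measurable [set x | f x <= g x].
Proof.
move=> mf mg; have := measurable_fun_ler mf mg.
by move=> /(_ measurableT [set true] Logic.I); rewrite setTI.
Qed.

(** * Tonelli's theorem for independent variables *)

Section fubini_indep.
Context {d d1 d2} {T : measurableType d} {T1 : measurableType d1}
  {T2 : measurableType d2} {R : realType} (P : probability T R).

Lemma measurable_fun_integral_comp (V : T -> T2) (h : T1 * T2 -> \bar R) :
  measurable_fun setT V -> measurable_fun setT h -> (forall p, 0 <= h p)%E ->
  measurable_fun setT (fun x => \int[P]_w h (x, V w))%E.
Proof.
move=> mV mh h0.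
apply: (measurable_fun_fubini_tonelli_F (fun p : T1 * T => h (p.1, V p.2))).
  apply: measurableT_comp => //; apply: measurable_fun_pair => //.
  exact: measurableT_comp.
by move=> p; exact: h0.
Qed.

(** The product formula on rectangles identifies the joint law of [U] and [V] with the product of
    their laws, to which Tonelli's theorem applies. *)
Lemma indep_fubini (U : T -> T1) (V : T -> T2) (h : T1 * T2 -> \bar R) :
  measurable_fun setT U -> measurable_fun setT V ->
  (forall A B, measurable A -> measurable B ->
     P (U @^-1` A `&` V @^-1` B) = (P (U @^-1` A) * P (V @^-1` B))%E) ->
  measurable_fun setT h -> (forall p, 0 <= h p)%E ->
  (\int[P]_w h (U w, V w) = \int[P]_w \int[P]_w' h (U w, V w'))%E.
Proof.
move=> mU mV indUV mh h0.
pose Uf : {mfun T >-> T1} := mfun_Sub (mem_set mU).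
pose Vf : {mfun T >-> T2} := mfun_Sub (mem_set mV).
have mUV : measurable_fun setT (fun w => (U w, V w)) by exact: measurable_fun_pair.
pose UVf : {mfun T >-> (T1 * T2)%type} := mfun_Sub (mem_set mUV).
transitivity (\int[distribution P UVf]_p h p)%E.
  by rewrite ge0_integral_distribution.
transitivity (\int[(distribution P Uf \x distribution P Vf)%E]_p h p)%E.
  apply: eq_measure_integral => A mA _.
  apply/esym/product_measure_unique => //= B C mB mC.
rewrite fubini_tonelli1// ge0_integral_distribution//; last 2 first.
- exact: measurable_fun_fubini_tonelli_F.
- by move=> y; apply: integral_ge0.
apply: eq_integral => w _; rewrite /fubini_F /=.
rewrite ge0_integral_distribution//; exact: measurable_fun_pair2.
Qed.

End fubini_indep.

Section blocks.
Context {d} {T : measurableType d} {R : realType} (P : probability T R).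
Context {I : choiceType} (X : I -> T -> R) (D : set I).
Hypothesis mX : forall i, D i -> measurable_fun setT (X i).

Lemma measurable_fun_cylinders (D1 : set I) (i : I) : D1 i ->
  measurable_fun setT (X i : g_sigma_algebraType (cylinders X D1) -> R).
Proof.
move=> D1i _ B mB; rewrite setTI; apply: sub_sigma_algebra.
exists [:: i], (fun=> B); split => // [j|].
  by rewrite inE => /eqP ->.
by apply/seteqP; split => w /=; [move=> h j /=; rewrite inE => /eqP ->|
  apply; rewrite /= inE].
Qed.

Lemma measurable_fun_block d1 (T1 : measurableType d1) (D1 : set I) (U : T -> T1) :
  D1 `<=` D ->
  measurable_fun setT (U : g_sigma_algebraType (cylinders X D1) -> T1) ->
  measurable_fun setT U.
Proof.
move=> D1D mU _ B mB; have := mU measurableT B mB.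
apply: smallest_sub; first exact: sigma_algebra_measurable.
by apply: cylinders_measurable => i /D1D; exact: mX.
Qed.

(* With V := id into a type carrying the sigma-algebra of a block, the integrand
   can be any function measurable with respect to that block. *)
Lemma block_fubini d1 d2 (T1 : measurableType d1) (T2 : measurableType d2)
  (D1 D2 : set I) (U : T -> T1) (V : T -> T2) (h : T1 * T2 -> \bar R) :
  mutually_independent P D X -> D1 `<=` D -> D2 `<=` D -> [disjoint D1 & D2] ->
  measurable_fun setT (U : g_sigma_algebraType (cylinders X D1) -> T1) ->
  measurable_fun setT (V : g_sigma_algebraType (cylinders X D2) -> T2) ->
  measurable_fun setT h -> (forall p, 0 <= h p)%E ->
  (\int[P]_w h (U w, V w) = \int[P]_w \int[P]_w' h (U w, V w'))%E.
Proof.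
move=> indX D1D D2D D12 mU mV mh h0.
apply: indep_fubini => //.
- exact: measurable_fun_block mU.
- exact: measurable_fun_block mV.
move=> A B mA mB.
have sA : <<s cylinders X D1 >> (U @^-1` A) by rewrite -[X in _ X]setTI; exact: mU.
have sB : <<s cylinders X D2 >> (V @^-1` B) by rewrite -[X in _ X]setTI; exact: mV.
exact: (@cylinders_indep _ _ _ P _ X D D1 D2 indX D1D D2D mX D12 _ _ sA sB).
Qed.

End blocks.

(** * The Poisson process *)

Section almost_sure.
Context {d} {T : measurableType d} {R : realType} (P : probability T R).

Lemma probability1_ae (A : set T) : measurable A -> P A = 1%E ->
  {ae P, forall x, A x}.
Proof.
move=> mA A1; exists (~` A); split => //; first exact: measurableC.
by rewrite probability_setC// A1 subee.
Qed.

Lemma ae_eq_probability (A B : set T) : measurable A -> measurable B ->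
  {ae P, forall x, A x <-> B x} -> P A = P B.
Proof.
move=> mA mB AB.
have -> : P A = (\int[P]_x (\1_A x)%:E)%E by rewrite integral_indic// setIT.
have -> : P B = (\int[P]_x (\1_B x)%:E)%E by rewrite integral_indic// setIT.
apply: ae_eq_integral => //; try exact/measurable_EFinP/measurable_indic.
apply: filterS AB => x AB _; rewrite !indicE; congr (_ _)%:E.
by congr (nat_of_bool _); apply/idP/idP; rewrite !inE => /AB.
Qed.

End almost_sure.

Section poisson.
Context {d} {T : measurableType d} {R : realType} (P : probability T R).
Variables (mu : R) (X : nat -> T -> R).
Hypotheses (mu0 : 0 < mu) (mX : forall j, measurable_fun setT (X j)).
Hypothesis tailX : forall j a, 0 <= a ->
  P [set w | a < X j w] = (expR (- (mu * a)))%:E.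
Hypothesis indX : mutually_independent P [set: nat] X.

Let N j w := \sum_(i < j) X i w.

Let mN j : measurable_fun setT (N j).
Proof. by apply: measurable_sum. Qed.

Lemma interarrivals_gt0 : {ae P, forall w, forall j, 0 < X j w}.
Proof.
apply/ae_foralln => j; apply: probability1_ae.
  exact: measurable_lt_set.
by rewrite tailX// mulr0 oppr0 expR0.
Qed.

(** The first m interarrival times are all at most [a] with probability q^m, where q = 1 - exp(- mu
    a) < 1, and q^m tends to 0. Together with positivity this carries the partial sums beyond any
    level. *)
Lemma interarrivals_unbounded (a : R) : 0 <= a ->
  {ae P, forall w, exists j, a < X j w}.
Proof.
move=> a0; exists (\bigcap_j (X j @^-1` `]-oo, a])); split; last first.
- move=> w /= nw j _ /=; rewrite in_itv/= leNgt; apply/negP => h.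
  by apply: nw; exists j.
- apply/eqP; rewrite eq_le measure_ge0 andbT.
  have pa j : P (X j @^-1` `]-oo, a]) = (1 - expR (- (mu * a)))%:E.
    rewrite EFinB -(tailX j a a0) -probability_setC; last exact: measurable_lt_set.
    by congr (P _); apply/seteqP; split => w /=; rewrite in_itv/= leNgt => /negP.
  have e01 : 0 <= 1 - expR (- (mu * a)) < 1.
    apply/andP; split; last by rewrite ltrBlDr ltrDl expR_gt0.
    by rewrite subr_ge0 -expR0 ler_expR oppr_le0 mulr_ge0 ?(ltW mu0).
  have le m : (P (\bigcap_j (X j @^-1` `]-oo, a])) <= ((1 - expR (- (mu * a))) ^+ m)%:E)%E.
    have := indX (iota 0 m) (fun=> `]-oo, a]%classic).
    rewrite iota_uniq => /(_ isT) h.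
    have {}h := h (fun i _ => conj I (measurable_itv _)).
    move: h; rewrite (eq_bigr (fun=> 1 - expR (- (mu * a)))); last by move=> i _; rewrite pa.
    rewrite big_const_seq count_predT size_iota iter_mulr_1 => <-.
    have mc : measurable (\bigcap_(i in [set i | i \in iota 0 m]) (X i @^-1` `]-oo, a])).
      apply: fin_bigcap_measurable => [|i _]; first exact: finite_seq.
      by rewrite -[X in measurable X]setTI; apply: mX.
    rewrite fineK ?fin_num_measure//; apply: le_measure; rewrite ?inE//.
    - apply: bigcapT_measurable => i.
      by rewrite -[X in measurable X]setTI; apply: mX.
    - by move=> w h i _; exact: h.
  have cv : ((1 - expR (- (mu * a))) ^+ m)%:E @[m --> \oo] --> 0%E.
    apply/cvg_EFin; first exact: nearW.
    apply: cvg_expr; rewrite ger0_norm; by case/andP: e01.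
  rewrite -(cvg_lim _ cv)//; apply: lime_ge; last exact: nearW.
  by apply/cvg_ex; eexists; exact: cv.
- apply: bigcapT_measurable => i.
  by rewrite -[X in measurable X]setTI; apply: mX.
Qed.

(* Condition on N_j, which is independent of X_j. *)
Lemma arrival_straddle j u v : u <= v ->
  P [set w | N j w <= u /\ v < N j.+1 w] =
  (\int[P]_w (if N j w <= u then expR (- (mu * (v - N j w))) else 0)%:E)%E.
Proof.
move=> uv.
pose C : set (R * R) := [set p | p.1 <= u /\ v < p.1 + p.2].
have mC : measurable C.
  apply: measurableI; first exact: measurable_le_set.
  by apply: measurable_lt_set => //; exact: measurable_funD.
have mA : measurable [set w | N j w <= u /\ v < N j.+1 w].
  by apply: measurableI; [exact: measurable_le_set|exact: measurable_lt_set].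
transitivity (\int[P]_w (\1_C (N j w, X j w))%:E)%E.
  rewrite -[X in P X]setIT -integral_indic//; apply: eq_integral => w _.
  rewrite !indicE; congr (_ _)%:E; congr (nat_of_bool _).
  by apply/idP/idP; rewrite !inE /C /= /N big_ord_recr.
rewrite (@block_fubini _ _ _ P nat X [set: nat] _ _ _ _ _ [set i | (i < j)%N] [set j]
  (N j) (X j) (fun p => (\1_C p)%:E))//; last 4 first.
- by apply/disj_set2P/seteqP; split => // i /= [ij ji]; move: ij; rewrite ji ltnn.
- apply: measurable_sum => i; apply: measurable_fun_cylinders => /=; exact: ltn_ord.
- exact: measurable_fun_cylinders.
- exact/measurable_EFinP/measurable_indic.
apply: eq_integral => w _; case: ifPn => Nu.
  rewrite -(tailX j); last by rewrite subr_ge0 (le_trans Nu).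
  rewrite -[X in P X]setIT -integral_indic//; last exact: measurable_lt_set.
  apply: eq_integral => w' _.
  rewrite !indicE; congr (_ _)%:E; congr (nat_of_bool _).
  apply/idP/idP; rewrite !inE /C /= ltrBlDl; first by case.
  by [].
rewrite integral0_eq// => w' _; rewrite indicE memNset// /C /=.
by case => Nu'; move: Nu; rewrite Nu'.
Qed.

(** In the integral formula for the straddling probability, exp(- mu (v - N)) splits as exp(- mu (v
    - u)) exp(- mu (u - N)), and the first factor is constant. *)
Lemma arrival_straddle_memoryless j u v : u <= v ->
  P [set w | N j w <= u /\ v < N j.+1 w] =
  ((expR (- (mu * (v - u))))%:E * P [set w | (N j w <= u)%R /\ (u < N j.+1 w)%R])%E.
Proof.
move=> uv; rewrite !arrival_straddle// -ge0_integralZl//; last 2 first.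
- apply/measurable_EFinP; apply: measurable_fun_ifT => //.
    exact: measurable_fun_ler.
  apply: measurableT_comp => //; apply: measurableT_comp => //.
  by apply: measurable_funM => //; apply: measurable_funB.
- by move=> w _; rewrite lee_fin; case: ifPn => // _; exact: expR_ge0.
apply: eq_integral => w _; rewrite -EFinM; congr (_%:E).
case: ifPn => _; last by rewrite mulr0.
by rewrite -expRD; congr expR; lra.
Qed.

Let Pos : set T := [set w | forall i, 0 < X i w].

Let mPos : measurable Pos.
Proof.
rewrite (_ : Pos = \bigcap_i [set w | 0 < X i w]).
  by apply: bigcapT_measurable => i; exact: measurable_lt_set.
by apply/seteqP; split => w /= h i; [move=> _; exact: h|exact: h].
Qed.

Let N_mono w i j : Pos w -> (i <= j)%N -> N i w <= N j w.
Proof.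
move=> Pw /subnKC <-; elim: (j - i)%N => [|k ih]; first by rewrite addn0.
by rewrite addnS (le_trans ih)// /N big_ord_recr /= lerDl ltW.
Qed.

(** Intersecting with [Pos] makes these sets disjoint everywhere and not just almost surely, as
    countable additivity demands; by [PA] it costs no probability. *)
Let A (u v : R) (j : nat) : set T := Pos `&` [set w | N j w <= u /\ v < N j.+1 w].

Let mA u v j : measurable (A u v j).
Proof.
apply: measurableI => //.
by apply: measurableI; [exact: measurable_le_set|exact: measurable_lt_set].
Qed.

Let PA u v j : P (A u v j) = P [set w | N j w <= u /\ v < N j.+1 w].
Proof.
apply: ae_eq_probability => //.
  by apply: measurableI; [exact: measurable_le_set|exact: measurable_lt_set].
apply: filterS interarrivals_gt0 => w Pw; split; first by case.
by move=> h; split.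
Qed.

(** For i < j, a common point would satisfy N_(i+1) <= N_j <= u <= v < N_(i+1). *)
Let trivA u v : u <= v -> trivIset setT (A u v).
Proof.
move=> uv; suff H i j w : (i < j)%N -> A u v i w -> A u v j w -> False.
  apply/trivIsetP => i j _ _ ij; apply/seteqP; split => // w [Ai Aj].
  by move: ij; rewrite neq_ltn => /orP[] /H; [apply; [exact: Ai|]|
    apply; [exact: Aj|]].
move=> ij [Pw [_ vN]] [_ [Nu _]].
by have := N_mono _ _ _ Pw ij; rewrite leNgt (le_lt_trans (le_trans Nu uv) vN).
Qed.

Lemma measurable_no_arrival u v :
  measurable [set w | forall j, N j.+1 w <= v -> N j.+1 w <= u].
Proof.
rewrite (_ : mkset _ = \bigcap_j ([set w | v < N j.+1 w] `|` [set w | N j.+1 w <= u])).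
  apply: bigcapT_measurable => j; apply: measurableU.
    exact: measurable_lt_set.
  exact: measurable_le_set.
apply/seteqP; split => w /= h j.
  by move=> _; case: (leP (N j.+1 w) v) => [/h|]; [right|left].
by move=> Nv; case: (h j I) => //=; rewrite ltNge Nv.
Qed.

(* Almost surely some N_j straddles v, i.e. N_j <= v < N_(j+1), and there is no
   arrival in ]u, v] exactly when moreover N_j <= u. *)
Let no_arrival_straddle u v : 0 <= u -> u <= v ->
  P [set w | forall j, N j.+1 w <= v -> N j.+1 w <= u] = P (\bigcup_j A u v j).
Proof.
move=> u0 uv; apply: ae_eq_probability => //.
- exact: measurable_no_arrival.
- exact: bigcup_measurable.
have v0 := le_trans u0 uv.
apply: filterS2 interarrivals_gt0 (interarrivals_unbounded v v0) => w Pw [k vk].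
split => [Ew|[j _ [_ [Nu vN]]] i Ni]; last first.
  apply: le_trans Nu; apply: N_mono => //; rewrite ltnNge; apply/negP => ji.
  by have := lt_le_trans vN (N_mono _ _ _ Pw (ji : (j.+1 <= i.+1)%N)); rewrite ltNge Ni.
have exN : exists m, v < N m w.
  exists k.+1; rewrite (lt_le_trans vk)// /N big_ord_recr /= lerDr.
  by apply: sumr_ge0 => i _; exact: ltW.
(* The first partial sum beyond [v] has positive index because N_0 = 0 <= v; its predecessor is
   either N_0 or an arrival at most [v], hence at most [u]. *)
case: (ex_minnP exN) => -[|m] vN mmin.
  by move: vN; rewrite /N big_ord0 ltNge v0.
exists m => //; split => //; split => //.
have : N m w <= v by rewrite leNgt; apply/negP => /mmin; rewrite ltnn.
by case: m {vN mmin} => [_|m /Ew//]; rewrite /N big_ord0.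
Qed.

(** Each straddling index contributes the same factor exp(- mu (v - u)), so the series is this
    factor times the total probability of straddling [u]. *)
Lemma no_arrival u v : 0 <= u -> u <= v ->
  P [set w | forall j, N j.+1 w <= v -> N j.+1 w <= u] = (expR (- (mu * (v - u))))%:E.
Proof.
move=> u0 uv; rewrite no_arrival_straddle// measure_bigcup//; last exact: trivA.
transitivity (\sum_(j <oo | j \in [set: nat]) ((expR (- (mu * (v - u))))%:E * P (A u u j)))%E.
  apply: eq_eseriesr => j _.
  by rewrite [LHS]PA arrival_straddle_memoryless// [in RHS]PA.
rewrite nneseriesZl// -[X in (_ * X)%E]measure_bigcup//; last exact: trivA.
rewrite -[RHS]mule1; congr (_ * _)%E.
(* That total is 1: for v = u the no-arrival condition is vacuous. *)
apply: etrans (esym (no_arrival_straddle u u u0 (lexx u))) _.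
by apply: etrans (probability_setT P); congr (P _); apply/seteqP; split => w //=.
Qed.

End poisson.

(** * The time since the last event *)

Section last_event.
Context {R : realType}.
Implicit Types (a : nat -> R) (t : R).

Definition has_event a t : bool := `[< exists j, a j <= t >].

(** A real-valued companion of [lastev]; the default value [t] makes it total, so that its
    measurability can be stated. *)
Definition last_time a t : R :=
  if has_event a t then sup [set a j | j in [set j | a j <= t]] else t.

Lemma lastevE a t :
  lastev a t = if has_event a t then Some (last_time a t) else None.
Proof. by rewrite /lastev /last_time /has_event; case: asboolP. Qed.

(** The set of past events is nonempty by [has_event] and bounded by [t], so its supremum obeys the
    usual criterion. This replaces the supremum by countably many comparisons. *)
Lemma last_time_le a t c : has_event a t ->
  (last_time a t <= c) <-> (forall j, a j <= t -> a j <= c).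
Proof.
move=> ha; rewrite /last_time ha; have [j0 j0t] := asboolW ha.
split => [h j jt|h]; last first.
  by apply: ge_sup; [exists (a j0), j0|move=> _ [j /= jt <-]; exact: h].
apply: le_trans h; apply: ub_le_sup; last by exists j.
by exists t => _ [i /= it <-].
Qed.

(* The minimum only matters when an event occurs at a time <= 0, which has
   probability 0; it makes the law of the gap exactly that of min(Y, t). *)
Definition gap a t : R :=
  if has_event a t then Num.min (t - last_time a t) t else t.

(** The right-hand side says that no event falls in ]t - c, t], which is the event whose probability
    [no_arrival] computes. *)
Lemma gap_ge a t c :
  (c <= gap a t) <-> (c <= t /\ forall j, a j <= t -> a j <= t - c).
Proof.
rewrite /gap; case: ifPn => ha; last first.
  split=> [ct|[]//]; split => // j jt; exfalso.
  by move/negP: ha; apply; apply/asboolP; exists j.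
rewrite le_min lerBrDl -lerBrDr; split.
  by move=> /andP[h ->]; split => //; exact/last_time_le.
by move=> [-> h]; rewrite andbT; exact/last_time_le.
Qed.

(** With all events at positive times, the gap alone reveals whether an event has occurred; the
    renewal integrand depends on process k only through its gap. *)
Lemma gap_lt a t : (forall j, 0 < a j) -> (gap a t < t) = has_event a t.
Proof.
move=> a0; rewrite /gap; case: ifPn => ha; last by rewrite ltxx.
rewrite gt_min ltxx orbF ltrBlDr ltrDl.
have [j jt] := asboolW ha; apply: lt_le_trans (a0 j) _.
by have [h _] := last_time_le a t (last_time a t) ha; apply: h.
Qed.

Lemma last_time_gap a t : (forall j, 0 < a j) -> has_event a t ->
  last_time a t = t - gap a t.
Proof.
move=> a0 ha; have := gap_lt a t a0; rewrite ha /gap ha gt_min ltxx orbF => h.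
by rewrite min_l ?(ltW h)//; lra.
Qed.

End last_event.

(** * Joint measurability in the time and the outcome *)

Section measurability.
Context {d} {T : measurableType d} {R : realType}.

Lemma measurable_evtime (X : nat -> T -> R) j :
  (forall i, measurable_fun setT (X i)) ->
  measurable_fun setT (fun w => evtime (fun i => X i w) j).
Proof. by move=> mX; rewrite /evtime; apply: measurable_sum. Qed.

Variables (a : nat -> T -> R).
Hypothesis ma : forall j, measurable_fun setT (a j).

Let ma2 j : measurable_fun setT (fun p : R * T => a j p.2).
Proof. exact: measurableT_comp. Qed.

Lemma measurable_has_event :
  measurable_fun setT (fun p : R * T => has_event (a ^~ p.2) p.1).
Proof.
apply: (measurable_fun_bool true); rewrite setTI.
rewrite (_ : _ @^-1` _ = \bigcup_j [set p : R * T | a j p.2 <= p.1]).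
  by apply: bigcupT_measurable => j; exact: measurable_le_set.
apply/seteqP; split => p /=.
  by move=> /eqP; rewrite eqb_id => /asboolP[j]; exists j.
by move=> [j _ jt]; apply/asboolP; exists j.
Qed.

(** By [last_time_le], a sublevel set is a countable intersection of comparisons on the part with an
    event, and a comparison with the default value elsewhere. *)
Lemma measurable_last_time :
  measurable_fun setT (fun p : R * T => last_time (a ^~ p.2) p.1).
Proof.
apply: (measurability _ (RGenOInfty.measurableE R)) => // _ [_ [x ->] <-].
pose H := [set p : R * T | has_event (a ^~ p.2) p.1].
have mH : measurable H.
  by have := measurable_has_event measurableT [set true] Logic.I; rewrite setTI.
rewrite setTI (_ : _ @^-1` _ = ~` (
    (H `&` \bigcap_j ([set p : R * T | p.1 < a j p.2] `|` [set p | a j p.2 <= x]))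
    `|` (~` H `&` [set p | p.1 <= x]))).
  apply: measurableC; apply: measurableU; apply: measurableI => //.
  - apply: bigcapT_measurable => j; apply: measurableU.
      exact: measurable_lt_set.
    exact: measurable_le_set.
  - exact: measurableC.
  - exact: measurable_le_set.
rewrite -[LHS]setCK; congr (~` _); apply/seteqP.
split => p /=; rewrite in_itv/= andbT.
  move=> /negP; rewrite -leNgt => px; have [Hp|Hp] := pselect (H p).
    left; split => // j _ /=; have [_|ja] := ltP p.1 (a j p.2); [by left|right].
    exact: (last_time_le (a ^~ p.2) _ _ Hp).1 px j ja.
  by right; split => //; move: px; rewrite /last_time ifF//; exact/negP.
move=> h; apply/negP; rewrite -leNgt; case: h => -[Hp h].
  apply/(last_time_le (a ^~ p.2) _ _ Hp) => j jp.
  by have [/=|//] := h j Logic.I; rewrite ltNge jp.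
by rewrite /last_time ifF//; exact/negP.
Qed.

Lemma measurable_gap : measurable_fun setT (fun p : R * T => gap (a ^~ p.2) p.1).
Proof.
apply: measurable_fun_ifT => //; first exact: measurable_has_event.
apply: measurable_minr => //; apply: measurable_funB => //.
exact: measurable_last_time.
Qed.

End measurability.

Section age.
Context {R : realType} (x0 : nat -> R).
Implicit Types (E : nat -> nat -> R) (t : R).

(** The age handed to node k. The source of age 0 counts as upstream of node 0, so that all nodes
    obey one recursion. *)
Definition prevage E (k : nat) t : R :=
  if k is k'.+1 then age x0 E k' t else 0.

Lemma ageE E k t : age x0 E k t =
  if has_event (E k) t
  then prevage E k (last_time (E k) t) + (t - last_time (E k) t)
  else x0 k + t.
Proof. by case: k => [|k] /=; rewrite lastevE; case: ifPn => //; rewrite add0r. Qed.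

Lemma age_gap E k t : (forall j, 0 < E k j) -> age x0 E k t =
  if gap (E k) t < t then prevage E k (t - gap (E k) t) + gap (E k) t
  else x0 k + t.
Proof.
move=> E0; rewrite ageE gap_lt//; case: ifPn => // h.
by rewrite last_time_gap//; congr (_ + _); lra.
Qed.

Context {d} {T : measurableType d} (X : nat -> nat -> T -> R).
Let E w l j := evtime (fun i => X l i w) j.

(** The sample space is arbitrary and only the processes up to k are assumed measurable, so the
    result also applies to the sigma-algebra that the lower processes generate. *)
Lemma measurable_age k :
  (forall l j, (l <= k)%N -> measurable_fun setT (X l j)) ->
  measurable_fun setT (fun p : R * T => age x0 (E p.2) k p.1).
Proof.
elim: k => [|k ih] mX.
  under eq_fun do rewrite ageE.
  have mE j : measurable_fun setT (fun w => E w 0%N j).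
    by apply: measurable_evtime => i; exact: mX.
  have ml := measurable_last_time _ mE.
  apply: measurable_fun_ifT; first exact: (measurable_has_event _ mE).
    by apply: measurable_funD => //; exact: measurable_funB.
  exact: measurable_funD.
under eq_fun do rewrite ageE.
have mE j : measurable_fun setT (fun w => E w k.+1 j).
  by apply: measurable_evtime => i; exact: mX.
have ml := measurable_last_time _ mE.
apply: measurable_fun_ifT; first exact: (measurable_has_event _ mE).
  apply: measurable_funD => //; last exact: measurable_funB.
  (* The upstream age is read at a random time, which is why the induction treats time and outcome
     jointly. *)
  have mp : measurable_fun setT
      (fun p : R * T => (last_time ((E p.2) k.+1) p.1, p.2)).
    exact: measurable_fun_pair.
  apply: (measurableT_comp (ih _) mp) => l j lk; apply: mX; exact: leqW.
exact: measurable_funD.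
Qed.

Lemma measurable_prevage k :
  (forall l j, (l < k)%N -> measurable_fun setT (X l j)) ->
  measurable_fun setT (fun p : R * T => prevage (E p.2) k p.1).
Proof.
by case: k => [_|k mX]; [exact: measurable_cst|exact: measurable_age].
Qed.

End age.

(** * The law of the time since the last event *)

Section density.
Context {d} {T : measurableType d} {R : realType}
  (m nu : {measure set T -> \bar R}) (p : T -> R).
Hypotheses (mp : measurable_fun setT p) (p0 : forall x, 0 <= p x).
Hypothesis mE : forall A, measurable A -> m A = (\int[nu]_(x in A) (p x)%:E)%E.

Let mpE : measurable_fun setT (EFin \o p).
Proof. exact/measurable_EFinP. Qed.

Let pE0 x : (0 <= (p x)%:E)%E.
Proof. by rewrite lee_fin. Qed.

Import HBNNSimple.

Let integral_density_nnsfun (f : {nnsfun T >-> R}) :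
  (\int[m]_x (f x)%:E = \int[nu]_x ((f x)%:E * (p x)%:E))%E.
Proof.
under [LHS]eq_integral do rewrite fimfunE -fsumEFin//.
rewrite [LHS]ge0_integral_fsum//; last 2 first.
  - by move=> r; exact/measurable_EFinP/measurableT_comp.
  - by move=> n x _; rewrite EFinM nnfun_muleindic_ge0.
under [RHS]eq_integral.
  move=> x xD; rewrite fimfunE -fsumEFin// muleC ge0_mule_fsumr; last first.
    by move=> r; rewrite EFinM nnfun_muleindic_ge0.
  over.
rewrite [RHS]ge0_integral_fsum//; last 2 first.
  - move=> r; apply: emeasurable_funM => //.
    exact/measurable_EFinP/measurableT_comp.
  - by move=> n x _; rewrite EFinM mule_ge0// nnfun_muleindic_ge0.
apply: eq_fsbigr => r rf.
have r0 : 0 <= r by move: rf; rewrite inE => -[x _ <-].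
under eq_integral do rewrite EFinM.
under [RHS]eq_integral do rewrite EFinM muleCA.
have mfr : measurable (f @^-1` [set r]) by exact: measurable_funPTI.
rewrite ge0_integralZl//; last exact/measurable_EFinP/measurable_indic.
rewrite ge0_integralZl//; last 2 first.
- apply: emeasurable_funM => //; exact/measurable_EFinP/measurable_indic.
- by move=> x _; rewrite mule_ge0// lee_fin.
congr (_ * _)%E; rewrite integral_indic// setIT.
rewrite mE// integral_mkcond.
apply: eq_integral => x _; rewrite patchE indicE.
by case: ifPn => h; rewrite (mule1, mule0).
Qed.

(** The formula holds for simple functions by linearity and passes to increasing limits by monotone
    convergence on both sides. *)
Lemma ge0_integral_density (f : T -> \bar R) :
  measurable_fun setT f -> (forall x, 0 <= f x)%E ->
  (\int[m]_x f x = \int[nu]_x (f x * (p x)%:E))%E.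
Proof.
move=> mf f0.
pose f_ := nnsfun_approx measurableT mf.
transitivity (limn (fun n => \int[m]_x (f_ n x)%:E))%E.
  rewrite -monotone_convergence//=.
  - apply: eq_integral => x _; apply/esym/cvg_lim => //=.
    exact: cvg_nnsfun_approx.
  - by move=> n; exact/measurable_EFinP/measurable_funTS.
  - by move=> n x _; rewrite lee_fin.
  - by move=> x _ i n mn; rewrite lee_fin; exact/lefP/nd_nnsfun_approx.
transitivity (limn (fun n => \int[nu]_x
    ((f_ n x)%:E * (p x)%:E)))%E.
  by congr (limn _); apply/funext => n; exact: integral_density_nnsfun.
rewrite -monotone_convergence//=.
- apply: eq_integral => x _; apply/cvg_lim => //=.
  rewrite muleC; under eq_fun do rewrite muleC.
  by apply: cvgeZl => //; exact: cvg_nnsfun_approx.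
- by move=> n; apply: emeasurable_funM => //; exact/measurable_EFinP/measurable_funTS.
- by move=> n x _; rewrite mule_ge0// lee_fin.
- move=> x _ i n mn; apply: lee_wpmul2r => //.
  by rewrite lee_fin; exact/lefP/nd_nnsfun_approx.
Qed.

End density.

Section exponential_law.
Context {R : realType} (mu : R) (mu0 : 0 < mu).

(* The probability structure of exponential_prob depends on a proof of 0 < mu
   that unification cannot find. *)
Definition exponential_law : probability (measurableTypeR R) R :=
  ltac:(refine (exponential_prob mu : probability _ R); exact mu0).

Local Notation Q := exponential_law.

Lemma exponential_law_itvcy a : 0 <= a -> Q `[a, +oo[%classic = (expR (- (mu * a)))%:E.
Proof.
move=> a0; rewrite /exponential_law /= /exponential_prob.
rewrite (@ge0_continuous_FTC2y R _ (fun x => - expR (- mu * x)) a 0)//.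
- by rewrite sub0e -EFinN opprK mulNr.
- by move=> x _; apply: exponential_pdf_ge0; exact: ltW.
- apply: (@continuous_subspaceW R^o _ _ [set` `[0, +oo[%R]).
    by move=> x /=; rewrite !in_itv/= !andbT; exact: le_trans.
  exact: within_continuous_exponential_pdf.
- rewrite -oppr0; apply: cvgN.
  rewrite (_ : (fun x => expR (- mu * x)) =
               (fun z => expR (- z)) \o (fun z => mu * z)); last first.
    by apply: eq_fun => x; rewrite mulNr.
  apply: (@cvg_comp _ _ _ _ _ _ (pinfty_nbhs R)); last exact: cvgr_expR.
  exact: gt0_cvgMry.
- apply: cvgN; apply: cvg_at_right_filter.
  by apply: continuous_comp; [exact: mulrl_continuous|exact: continuous_expR].
- move=> x; rewrite in_itv/= andbT => ax.
  by apply: derive1_exponential_pdf; rewrite in_itv/= andbT (le_lt_trans a0).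
Qed.

(** The density of rate mu multiplied by exp(s x) is mu / (mu - s) times the density of rate mu - s,
    whose total mass is 1. *)
Lemma integral_exp_exponential_law s : s < mu ->
  (\int[exponential_law]_x (expR (s * x))%:E = (mu / (mu - s))%:E)%E.
Proof.
move=> smu; have ms0 : 0 < mu - s by rewrite subr_gt0.
have mpdf r : measurable_fun (setT : set (measurableTypeR R))
    (EFin \o exponential_pdf r).
  by apply/measurable_EFinP; exact: measurable_exponential_pdf.
rewrite (@ge0_integral_density _ _ _ _ lebesgue_measure (exponential_pdf mu))//.
- rewrite -[RHS]mule1 -(integral_exponential_pdf ms0) -ge0_integralZl//; last 3 first.
  + exact: mpdf.
  + by move=> x _; rewrite lee_fin; apply: exponential_pdf_ge0; exact: ltW.
  + by rewrite lee_fin divr_ge0// ltW.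
  apply: eq_integral => x _; rewrite -!EFinM; congr (_%:E).
  have [x0|x0] := ltP x 0; first by rewrite !lt0_exponential_pdf// !mulr0.
  rewrite !exponential_pdfE// [RHS]mulrA divfK ?gt_eqF// mulrCA -expRD.
  by congr (_ * expR _); lra.
- exact: measurable_exponential_pdf.
- by move=> x; apply: exponential_pdf_ge0; exact: ltW.
- by apply/measurable_EFinP; exact: measurableT_comp.
Qed.

End exponential_law.

(** Two laws that agree on a generating pi-system covering the space are equal. *)
Lemma ge0_integral_eq_law {d1 d2 d3} {T1 : measurableType d1}
    {T2 : measurableType d2} {T3 : measurableType d3} {R : realType}
    (P1 : probability T1 R) (P2 : probability T2 R) (U1 : T1 -> T3) (U2 : T2 -> T3)
    (G : set (set T3)) (F : (set T3)^nat) (g : T3 -> \bar R) :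
  measurable_fun setT U1 -> measurable_fun setT U2 ->
  measurable = <<s G >> -> setI_closed G -> (forall i, G (F i)) ->
  \bigcup_k F k = setT ->
  (forall A, G A -> P1 (U1 @^-1` A) = P2 (U2 @^-1` A)) ->
  measurable_fun setT g -> (forall x, 0 <= g x)%E ->
  (\int[P1]_x g (U1 x) = \int[P2]_x g (U2 x))%E.
Proof.
move=> mU1 mU2 mG GI GF FT GE mg g0.
pose V1 : {mfun T1 >-> T3} := mfun_Sub (mem_set mU1).
pose V2 : {mfun T2 >-> T3} := mfun_Sub (mem_set mU2).
transitivity (\int[distribution P1 V1]_x g x)%E.
  by rewrite ge0_integral_distribution.
transitivity (\int[distribution P2 V2]_x g x)%E; last first.
  by rewrite ge0_integral_distribution.
apply: eq_measure_integral => A mA _.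
apply: (measure_unique G F) => // k.
by rewrite (le_lt_trans (probability_le1 _ _)) ?ltry// mG; exact: sub_sigma_algebra.
Qed.

Section gap_law.
Context {d} {T : measurableType d} {R : realType} (P : probability T R).
Variables (mu : R) (X : nat -> T -> R).
Hypotheses (mu0 : 0 < mu) (mX : forall j, measurable_fun setT (X j)).
Hypothesis tailX : forall j a, 0 <= a ->
  P [set w | a < X j w] = (expR (- (mu * a)))%:E.
Hypothesis indX : mutually_independent P [set: nat] X.

Local Notation gapX t w := (gap (evtime (fun i => X i w)) t).

Let mgap t : measurable_fun setT (fun w => gapX t w).
Proof.
have mg := measurable_gap _ (fun j => measurable_evtime X j mX).
exact: (measurable_fun_pair2 t mg).
Qed.

Lemma gap_law t c : 0 <= t -> P [set w | c <= gapX t w] =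
  exponential_law mu mu0 [set x | c <= Num.min x t].
Proof.
move=> t0; have [tc|ct] := ltP t c.
  rewrite (_ : mkset _ = set0); last first.
    apply/seteqP; split => w //=.
    by move/(gap_ge _ _ _).1 => [ct]; move: tc; rewrite ltNge ct.
  rewrite measure0 (_ : mkset _ = set0) ?measure0//.
  apply/seteqP; split => w //=.
  by rewrite le_min => /andP[_ ct]; move: tc; rewrite ltNge ct.
(* For negative [c] both sides are 1; on the exponential side this follows by monotonicity from the
   case c = 0. *)
wlog c0 : c ct / 0 <= c.
  move=> H; have [/H->//|c0] := leP 0 c.
  have := H 0 t0 (lexx _).
  rewrite (_ : mkset _ = setT); last first.
    apply/seteqP; split => w //= _; apply/(gap_ge _ _ _); split => // j.
    by rewrite subr0.
  rewrite probability_setT => /esym Q0.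
  rewrite (_ : mkset _ = setT); last first.
    apply/seteqP; split => w //= _; apply/(gap_ge _ _ _); split => // j.
    by move/le_trans; apply; lra.
  rewrite probability_setT; apply/eqP; rewrite eq_le; apply/andP; split.
    rewrite -[leLHS]Q0; apply: le_measure; rewrite ?inE.
    - by apply: measurable_le_set => //; exact: measurable_minr.
    - by apply: measurable_le_set => //; exact: measurable_minr.
    - by move=> x /=; apply: le_trans; exact: ltW.
  by apply: probability_le1; apply: measurable_le_set => //; exact: measurable_minr.
have -> : [set x | c <= Num.min x t] = `[c, +oo[%classic.
  by apply/seteqP; split => x /=; rewrite in_itv/= le_min ct !andbT.
rewrite exponential_law_itvcy//.
have -> : [set w | c <= gapX t w] = [set w | forall j,
    \sum_(i < j.+1) X i w <= t -> \sum_(i < j.+1) X i w <= t - c].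
  apply/seteqP; split => w /=; first by move/(gap_ge _ _ _).1 => [].
  by move=> h; apply/(gap_ge _ _ _).
rewrite (no_arrival P mu X)//.
- by congr (expR _)%:E; lra.
- by rewrite subr_ge0.
- by rewrite gerBl.
Qed.

(** Closed rays unbounded above generate the Borel sets, are stable under intersection and cover the
    line, so the equality of tails in [gap_law] suffices. *)
Lemma integral_gap t (g : R -> \bar R) : 0 <= t ->
  measurable_fun setT g -> (forall x, 0 <= g x)%E ->
  (\int[P]_w g (gapX t w) = \int[exponential_law mu mu0]_x g (Num.min x t))%E.
Proof.
move=> t0 mg g0.
apply: (@ge0_integral_eq_law _ _ _ T (measurableTypeR R) (measurableTypeR R) R
  P (exponential_law mu mu0) (fun w => gapX t w) (fun x => Num.min x t)
  (@RGenCInfty.G R) (fun n => `[- n%:R, +oo[%classic)) => //.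
- exact: mgap.
- exact: measurable_minr.
- exact: RGenCInfty.measurableE.
- move=> _ _ [x ->] [y ->]; exists (Num.max x y).
  by apply/seteqP; split => z /=; rewrite !in_itv/= !andbT ge_max => /andP.
- by move=> i; exists (- i%:R).
- apply/seteqP; split => // x _; exists (Num.truncn `|x|).+1 => //=.
  rewrite in_itv/= andbT lerNl; apply: le_trans (ler_norm _) _; rewrite normrN.
  by apply/ltW; exact: truncnS_gt.
- by move=> _ [x ->]; have := gap_law t x t0; rewrite !preimage_itvcy.
Qed.

End gap_law.

(** * The renewal equation *)

Section network.
Context {R : realType} {d : measure_display} {Omega : measurableType d}
  (P : probability Omega R) (n : nat) (mu : nat -> R)
  (S : nat -> nat -> Omega -> R) (x0 : nat -> R).
Hypothesis mu0 : forall l, (l < n)%N -> 0 < mu l.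
Hypothesis mS : forall l j, (l < n)%N -> measurable_fun setT (S l j).
Hypothesis tailS : forall l j a, (l < n)%N -> 0 <= a ->
  P [set w | a < S l j w] = (expR (- (mu l * a)))%:E.
Hypothesis indS : mutually_independent P [set p : nat * nat | (p.1 < n)%N]
  (fun p => S p.1 p.2).

Local Notation E w := (fun l j => evtime (fun i => S l i w) j).

Lemma mutually_independent_process k : (k < n)%N ->
  mutually_independent P [set: nat] (S k).
Proof.
move=> kn F B uF HB.
have := indS (map (pair k) F) (fun p => B p.2).
rewrite map_inj_uniq; last by move=> i j [].
move=> /(_ uF); rewrite big_map => <-; last first.
  by move=> _ /mapP[i iF ->]; split => //=; have [] := HB i iF.
congr (fine (P _)); apply/seteqP; split => w h i /=.
  by move=> /mapP[j jF ->]; exact: h.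
by move=> iF; have := h (k, i); apply; apply: map_f.
Qed.

Lemma events_gt0 k : (k < n)%N -> {ae P, forall w, forall j, 0 < E w k j}.
Proof.
move=> kn.
apply: filterS (interarrivals_gt0 P (mu k) (S k) _ _) => [w Sw j|j|j a a0].
- rewrite /evtime big_ord_recr /= ltr_wpDl//.
  by apply: sumr_ge0 => i _; exact: ltW.
- exact: mS.
- exact: tailS.
Qed.

(** This is f_(k-1) in the notation of the overview. Values in the extended reals let the renewal
    equation be proved before finiteness is known. *)
Definition exp_moment s k t : \bar R :=
  (\int[P]_w (expR (s * prevage x0 (E w) k t))%:E)%E.

Lemma measurable_exp_prevage d' (T : measurableType d') (X : nat -> nat -> T -> R) s k :
  (forall l j, (l < k)%N -> measurable_fun setT (X l j)) ->
  measurable_fun setT (fun p : R * T =>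
    (expR (s * prevage x0 (fun l j => evtime (fun i => X l i p.2) j) k p.1))%:E).
Proof.
move=> mX; apply/measurable_EFinP; apply: measurableT_comp => //.
by apply: measurable_funM => //; exact: measurable_prevage.
Qed.

Lemma measurable_exp_moment s k : (k <= n)%N ->
  measurable_fun setT (exp_moment s k).
Proof.
move=> kn; apply: (measurable_fun_fubini_tonelli_F
  (fun p : R * Omega => (expR (s * prevage x0 (E p.2) k p.1))%:E)).
  apply: measurable_exp_prevage => l j lk; apply: mS; exact: leq_trans kn.
by move=> p; rewrite lee_fin expR_ge0.
Qed.

Lemma exp_moment_ge0 s k t : (0 <= exp_moment s k t)%E.
Proof. by apply: integral_ge0 => w _; rewrite lee_fin expR_ge0. Qed.

Lemma exp_moment0 s t : exp_moment s 0 t = 1%E.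
Proof.
rewrite /exp_moment /=; under eq_integral do rewrite mulr0 expR0.
by rewrite integral_cst// [X in (_ * X)%E]probability_setT mule1.
Qed.

Definition renewal s k t x : \bar R :=
  (if (x < t)%R then (expR (s * x))%:E * exp_moment s k (t - x)
   else (expR (s * (x0 k + t)))%:E)%E.

Lemma exp_moment_renewal s k t (kn : (k < n)%N) : 0 <= t ->
  exp_moment s k.+1 t =
  (\int[exponential_law (mu k) (mu0 k kn)]_x renewal s k t x)%E.
Proof.
move=> t0.
pose D1 := [set p : nat * nat | p.1 = k].
pose D2 := [set p : nat * nat | (p.1 < k)%N].
pose S' := fun p : nat * nat => S p.1 p.2.
pose T2 : measurableType _ := g_sigma_algebraType (cylinders S' D2).
(* The first variable stands for the gap of process k, while the second enters only through the
   processes of smaller index. *)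
pose h := fun p : R * T2 => (if (p.1 < t)%R then
   (expR (s * p.1))%:E * (expR (s * prevage x0 (E p.2) k (t - p.1)))%:E
   else (expR (s * (x0 k + t)))%:E)%E.
have mS' p : p.1 = k -> measurable_fun setT (S' p : g_sigma_algebraType (cylinders S' D1) -> R).
  by move=> pk; exact: measurable_fun_cylinders.
have mU : measurable_fun setT ((fun w => gap (E w k) t) :
    g_sigma_algebraType (cylinders S' D1) -> R).
  have mE j : measurable_fun setT ((fun w => E w k j) :
      g_sigma_algebraType (cylinders S' D1) -> R).
    by apply: measurable_evtime => i; exact: (mS' (k, i)).
  exact: (measurable_fun_pair2 t (measurable_gap _ mE)).
have mh : measurable_fun setT h.
  have mlt : measurable_fun setT (fun p : R * T2 => p.1 < t).
    exact: measurable_fun_ltr.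
  apply: measurable_fun_ifT => //; apply: emeasurable_funM.
    apply/measurable_EFinP; apply: measurableT_comp => //.
    exact: measurable_funM.
  have mp : measurable_fun setT (fun p : R * T2 => (t - p.1, p.2)).
    by apply: measurable_fun_pair => //; exact: measurable_funB.
  have mq := measurable_exp_prevage _ T2 (S : nat -> nat -> T2 -> R) s k.
  apply: (measurableT_comp (mq _) mp) => l j lk.
  exact: (measurable_fun_cylinders S' D2 (l, j)).
have h0 p : (0 <= h p)%E.
  by rewrite /h; case: ifPn => _; rewrite ?mule_ge0// lee_fin expR_ge0.
have mage : measurable_fun setT (fun p : R * Omega => age x0 (E p.2) k p.1).
  by apply: measurable_age => l j lk; apply: mS; exact: leq_ltn_trans kn.
have mSn p : (p.1 < n)%N -> measurable_fun setT (S' p) by exact: mS.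
have D1n : D1 `<=` [set p : nat * nat | (p.1 < n)%N] by move=> p /= ->.
have D2n : D2 `<=` [set p : nat * nat | (p.1 < n)%N].
  by move=> p /=; move/ltn_trans; apply.
have mV : measurable_fun setT (id : T2 -> T2) by exact: measurable_id.
have D12 : [disjoint D1 & D2].
  apply/disj_set2P/seteqP; split => // p /= [pk]; rewrite /D2 /= pk.
  by rewrite ltnn.
(* The two integrands agree wherever all events of process k occur at positive times, hence almost
   surely. *)
transitivity (\int[P]_w h (gap (E w k) t, w))%E.
  apply: ae_eq_integral => //.
  - apply/measurable_EFinP; apply: measurableT_comp => //.
    by apply: measurable_funM => //; exact: (measurable_fun_pair2 t mage).
  - apply: (measurableT_comp mh).
    apply: measurable_fun_pair.
      exact: (measurable_fun_block S' _ mSn _ _ _ _ D1n mU).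
    exact: (measurable_fun_block S' _ mSn _ _ _ _ D2n mV).
  - apply: filterS (events_gt0 k kn) => w Ew _.
    rewrite /h /= age_gap//; case: ifPn => // _.
    by rewrite -EFinM -expRD; congr (expR _)%:E; lra.
rewrite (block_fubini P S' _ mSn _ _ R T2 D1 D2 (fun w => gap (E w k) t) (id : Omega -> T2) h)//.
rewrite (integral_gap P (mu k) (S k) (mu0 k kn) _ _ _ t
  (fun b => \int[P]_w' h (b, w'))%E)//; last 5 first.
- by move=> j; exact: mS.
- by move=> j a; exact: tailS.
- exact: mutually_independent_process.
- apply: (measurable_fun_integral_comp P (id : Omega -> T2)) => //.
  exact: (measurable_fun_block S' _ mSn _ _ _ _ D2n mV).
- by move=> x; exact: integral_ge0.
(* The gap is now [Num.min x t], which is below [t] exactly when [x] is, and then equals [x]. *)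
apply: eq_integral => x _; rewrite /renewal /h /= gt_min ltxx orbF.
case: ifPn => xt; last by rewrite integral_cst// [X in (_ * X)%E]probability_setT mule1.
rewrite min_l ?(ltW xt)// ge0_integralZl//.
- apply/measurable_EFinP; apply: measurableT_comp => //.
  apply: measurable_funM => //.
  apply: (measurable_fun_pair2 (t - x) (measurable_prevage x0 S k _)) => l j lk.
  by apply: mS; exact: ltn_trans kn.
Qed.

End network.

(** * The limit *)

Section renewal_limit.
Context {R : realType} (mu s c C L : R) (mu0 : 0 < mu) (H : R -> \bar R).
Hypotheses (smu : s < mu) (C0 : 0 <= C) (L0 : 0 <= L).
Hypotheses (mH : measurable_fun setT H) (H0 : forall t, (0 <= H t)%E).
Hypothesis HC : forall t, 0 <= t -> (H t <= C%:E)%E.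
Hypothesis HL : H t @[t --> +oo] --> L%:E.

Local Notation Q := (exponential_law mu mu0).

(** The integrand [renewal], with [H] for the upstream moment and [c] for the initial age. *)
Let g t x : \bar R :=
  (if (x < t)%R then (expR (s * x))%:E * H (t - x)
   else (expR (s * (c + t)))%:E)%E.

(** A majorant free of [t]: the product dominates both C exp(s x), for x < t, and exp(s c) (exp(s x)
    + 1), for x >= t. *)
Let bound x : R := (C + expR (s * c)) * (expR (s * x) + 1).

Let g0 t x : (0 <= g t x)%E.
Proof. by rewrite /g; case: ifPn => _; rewrite ?mule_ge0// lee_fin expR_ge0. Qed.

Let g_bound t x : 0 <= t -> (g t x <= (bound x)%:E)%E.
Proof.
move=> t0; rewrite /g /bound; case: ifPn => [xt|].
  apply: (@le_trans _ _ ((expR (s * x))%:E * C%:E)%E).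
    by apply: lee_wpmul2l; [rewrite lee_fin expR_ge0|apply: HC; lra].
  rewrite -EFinM lee_fin.
  have := expR_gt0 (s * x); have := expR_gt0 (s * c) => e1 e2.
  have e12 := mulr_gt0 e1 e2.
  rewrite -subr_ge0 [X in 0 <= X](_ : _ = C + expR (s * c) * expR (s * x) + expR (s * c)).
    by rewrite !addr_ge0// ltW.
  by ring.
rewrite -leNgt => tx; rewrite lee_fin mulrDr expRD.
(* For s >= 0 the left side is at most exp(s x) since t <= x; for s < 0 it is at most 1. *)
have h : expR (s * t) <= expR (s * x) + 1.
  have [s0|s0] := leP 0 s.
    by apply: (@le_trans _ _ (expR (s * x))); [rewrite ler_expR ler_wpM2l|rewrite lerDl].
  apply: (@le_trans _ _ 1); last by rewrite lerDr expR_ge0.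
  by rewrite -expR0 ler_expR mulr_le0_ge0// ltW.
have := expR_gt0 (s * x); have := expR_gt0 (s * c) => e1 e2.
apply: (@le_trans _ _ (expR (s * c) * (expR (s * x) + 1))).
  by rewrite ler_pM2l.
by rewrite ler_wpM2r ?lerDr// addr_ge0 ?ltW.
Qed.

Let mexp : measurable_fun (setT : set (measurableTypeR R)) (fun x => (expR (s * x))%:E).
Proof. by apply/measurable_EFinP; exact: measurableT_comp. Qed.

Let mg t : measurable_fun (setT : set (measurableTypeR R)) (g t).
Proof.
apply: measurable_fun_ifT => //.
  by apply: measurable_fun_ltr => //; exact: measurable_id.
apply: emeasurable_funM => //.
apply: (measurableT_comp mH); exact: measurable_funB.
Qed.

Let integral_bound :
  (\int[Q]_x (bound x)%:E = ((C + expR (s * c)) * (mu / (mu - s) + 1))%:E)%E.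
Proof.
have Ce : 0 <= C + expR (s * c) by rewrite addr_ge0// expR_ge0.
under eq_integral do rewrite /bound EFinM.
rewrite ge0_integralZl//; last first.
  by apply/measurable_EFinP; apply: measurable_funD => //; exact/measurable_EFinP.
under eq_integral do rewrite EFinD.
rewrite ge0_integralD//.
rewrite integral_exp_exponential_law// integral_cst//.
by rewrite [X in (_ + _ * X)%E]probability_setT mule1 EFinM EFinD.
Qed.

Lemma renewal_bounded t : 0 <= t ->
  (\int[Q]_x g t x <= ((C + expR (s * c)) * (mu / (mu - s) + 1))%:E)%E.
Proof.
move=> t0; rewrite -integral_bound; apply: ge0_le_integral => //.
- apply/measurable_EFinP; apply: measurable_funM => //.
  by apply: measurable_funD => //; exact/measurable_EFinP.
- by move=> x _; exact: g_bound.
Qed.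

Lemma renewal_cvg : (\int[Q]_x g t x)%E @[t --> +oo] --> (mu / (mu - s) * L)%:E.
Proof.
apply/cvge_pinftyP => u uoo.
(* Domination is known at nonnegative times only; truncating at 0 changes finitely many terms of the
   sequence. *)
pose v i := Num.max (u i) 0.
have uv : \forall i \near \oo, v i = u i.
  near=> i; rewrite /v max_l//; near: i.
  by move/cvgryPge : uoo; exact.
have voo : v i @[i --> \oo] --> +oo.
  apply/cvgryPge => A; move/cvgryPge : uoo => /(_ A).
  by apply: filterS => i Au; rewrite le_max Au.
have gv : (\int[Q]_x g (v i) x)%E @[i --> \oo] --> (mu / (mu - s) * L)%:E.
  have -> : (mu / (mu - s) * L)%:E = (\int[Q]_x (L%:E * (expR (s * x))%:E))%E.
    rewrite ge0_integralZl//.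
    by rewrite integral_exp_exponential_law// -EFinM mulrC.
  have [] // := @dominated_convergence _ _ _ Q setT measurableT
    (fun i => g (v i)) (fun x => L%:E * (expR (s * x))%:E)%E (EFin \o bound).
  - by apply: emeasurable_funM => //.
  - apply: aeW => x _.
    have vx : v i - x @[i --> \oo] --> +oo.
      apply/cvgryPge => A; move/cvgryPge : voo => /(_ (A + x)).
      by apply: filterS => i; rewrite lerBrDr.
    have Hv : ((expR (s * x))%:E * H (v i - x))%E @[i --> \oo] -->
        ((expR (s * x))%:E * L%:E)%E.
      by apply: cvgeZl => //; exact: (cvg_comp _ _ vx HL).
    (* For fixed [x] the time eventually exceeds [x], and the branch of the initial age
       disappears. *)
    rewrite muleC; apply: cvg_trans Hv; apply: near_eq_cvg.
    near=> i; rewrite /g ifT//; near: i.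
    by move/cvgryPgt : voo; exact.
  - apply/integrableP; split.
      apply/measurable_EFinP; apply: measurable_funM => //.
      by apply: measurable_funD => //; exact/measurable_EFinP.
    under eq_integral => x _.
      rewrite gee0_abs; last by apply: le_trans (g_bound 0 x (lexx _)); exact: g0.
      over.
    by rewrite /= integral_bound ltry.
  - apply: aeW => x i _; rewrite gee0_abs//; apply: g_bound.
    by rewrite /v le_max lexx orbT.
apply: cvg_trans gv; apply: near_eq_cvg.
by apply: filterS uv => i ->.
Unshelve. all: by end_near. Qed.

End renewal_limit.

(** * Induction along the line *)

Section network_limit.
Context {R : realType} {d : measure_display} {Omega : measurableType d}
  (P : probability Omega R) (n : nat) (mu : nat -> R)
  (S : nat -> nat -> Omega -> R) (x0 : nat -> R).
Hypothesis mu0 : forall l, (l < n)%N -> 0 < mu l.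
Hypothesis mS : forall l j, (l < n)%N -> measurable_fun setT (S l j).
Hypothesis tailS : forall l j a, (l < n)%N -> 0 <= a ->
  P [set w | a < S l j w] = (expR (- (mu l * a)))%:E.
Hypothesis indS : mutually_independent P [set p : nat * nat | (p.1 < n)%N]
  (fun p => S p.1 p.2).

(** The uniform bound is proved along with the limit because the next node needs it for dominated
    convergence; both start from the constant 1. *)
Lemma exp_moment_cvg s k : (k <= n)%N -> (forall i, (i < n)%N -> s < mu i) ->
  (exists2 C : R, 0 <= C &
    forall t, 0 <= t -> (exp_moment P S x0 s k t <= C%:E)%E) /\
  exp_moment P S x0 s k t @[t --> +oo] --> (\prod_(i < k) (mu i / (mu i - s)))%:E.
Proof.
move=> + smu; elim: k => [_|k ih kn].
  have -> : exp_moment P S x0 s 0 = cst 1%E.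
    by apply/funext => t; exact: exp_moment0.
  by split; [exists 1|rewrite big_ord0; exact: cvg_cst].
have [[C C0 HC] HL] := ih (ltnW kn).
have mH := measurable_exp_moment P n S x0 mS s k (ltnW kn).
have H0 := exp_moment_ge0 P S x0 s k.
have HE := exp_moment_renewal P n mu S x0 mu0 mS tailS indS s k.
split.
  exists ((C + expR (s * x0 k)) * (mu k / (mu k - s) + 1)).
    rewrite mulr_ge0// addr_ge0// ?expR_ge0// divr_ge0 ?(ltW (mu0 _ kn))//.
    by rewrite subr_ge0 ltW// smu.
  move=> t t0; rewrite (HE _ kn)//.
  exact: (renewal_bounded _ _ _ _ _ _ (smu _ kn) C0 mH H0 HC).
have L0 : 0 <= \prod_(i < k) (mu i / (mu i - s)).
  apply: prodr_ge0 => i _; have ik : (i < n)%N by exact: ltn_trans (ltn_ord i) kn.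
  by rewrite divr_ge0 ?(ltW (mu0 _ ik))// subr_ge0 ltW// smu.
rewrite big_ord_recr/= mulrC.
have := renewal_cvg _ _ (x0 k) _ _ (mu0 _ kn) _ (smu _ kn) C0 L0 mH H0 HC HL.
apply: cvg_trans; apply: near_eq_cvg; near=> t.
(* The renewal equation is available at nonnegative times, which is enough near infinity. *)
by rewrite (HE _ kn)//; near: t; exact: nbhs_pinfty_ge.
Unshelve. all: by end_near. Qed.

End network_limit.

Lemma exists_pos_lower_bound {R : realType} (n : nat) (mu : nat -> R) :
  (forall l, (l < n)%N -> 0 < mu l) ->
  exists2 m, 0 < m & forall l, (l < n)%N -> m <= mu l.
Proof.
(* Starting at 1, the induction produces the minimum of 1 and the rates. *)
elim: n => [_|n ih mu0]; first by exists 1.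
have [m m0 mP] := ih (fun l ln => mu0 l (ltnW ln)).
exists (Num.min m (mu n)); first by rewrite lt_min m0 mu0.
move=> l; rewrite ltnS leq_eqVlt => /orP[/eqP->|ln].
  by rewrite ge_min lexx orbT.
by rewrite ge_min mP.
Qed.

Theorem theorem5 (R : realType) (d : measure_display) (Omega : measurableType d)
    (P : probability Omega R) (n : nat) (mu : nat -> R)
    (S : nat -> nat -> Omega -> R) (x0 : nat -> R) :
  (forall l, (l < n)%N -> 0 < mu l) ->
  (forall i, (i < n)%N -> 0 <= x0 i) ->
  (forall l j, (l < n)%N -> measurable_fun setT (S l j)) ->
  (forall l j a, (l < n)%N -> 0 <= a ->
     P [set w | a < S l j w] = (expR (- (mu l * a)))%:E) ->
  mutually_independent P [set p : nat * nat | (p.1 < n)%N]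
    (fun p => S p.1 p.2) ->
  exists s0 : R, 0 < s0 /\
    forall s : R, s < s0 -> forall k : nat, (k < n)%N ->
      (fun t : R =>
         (\int[P]_w (expR (s * age x0 (fun l j => evtime (fun i => S l i w) j) k t))%:E)%E)
        @ +oo --> (\prod_(i < k.+1) (mu i / (mu i - s)))%:E.
Proof.
move=> mu0 _ mS tailS indS.
have [s0 s00 s0P] := exists_pos_lower_bound n mu mu0.
exists s0; split => // s ss0 k kn.
have smu i : (i < n)%N -> s < mu i by move=> /s0P; exact: lt_le_trans.
(* The age of node k is [prevage] at k + 1, hence the shifted index. *)
exact: (exp_moment_cvg P n mu S x0 mu0 mS tailS indS s k.+1 kn smu).2.
Qed.
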